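(* Let $(\mathfrak g,[-,-],\rhd)$ be a post-Lie algebra over a field $\mathbf k$ of characteristic $p>0$, let $\mathrm U(\mathfrak g)$ be the universal enveloping algebra of $(\mathfrak g,[-,-])$ with the Guin-Oudom extension of $\rhd$, and let $\mathfrak g^{(p)}=\mathrm{span}_{\mathbf k}\{x^{p^k}\in\mathrm U(\mathfrak g)\mid x\in\mathfrak g,\ k\ge0\}$ be the space of primitive elements of $\mathrm U(\mathfrak g)$. Then in $\mathrm U(\mathfrak g)$ $$y\rhd x^p=[\underbrace{x,[x,[\cdots[x}_{p-1},y\rhd x]\cdots]]],\qquad x,y\in\mathfrak g^{(p)},$$ where $[-,-]$ is the commutator of $\mathrm U(\mathfrak g)$.
   Context: Convention: $\mathbf k$ is an algebraically closed field of prime characteristic $p$; everything is over $\mathbf k$. Post-Lie algebra: a Lie algebra $(\mathfrak g,[-,-])$ with a bilinear product $\rhd$ such that $x\rhd[y,z]=[x\rhd y,z]+[y,x\rhd z]$ and $([x,y]+x\rhd y-y\rhd x)\rhd z=x\rhd(y\rhd z)-y\rhd(x\rhd z)$. Guin-Oudom extension: $\mathrm U(\mathfrak g)$ carries its usual cocommutative Hopf structure (elements of $\mathfrak g$ primitive; Sweedler notation $\Delta(x)=x_1\otimes x_2$; counit $\varepsilon$). The product $\rhd$ of $\mathfrak g$ extends uniquely to a coalgebra map $\rhd:\mathrm U(\mathfrak g)\otimes\mathrm U(\mathfrak g)\to\mathrm U(\mathfrak g)$ with $1\rhd z=z$, $x\rhd1=\varepsilon(x)1$, $x\rhd(yz)=(x_1\rhd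 y)(x_2\rhd z)$ and $x\rhd(y\rhd z)=(x_1(x_2\rhd y))\rhd z$ for all $x,y,z\in\mathrm U(\mathfrak g)$. *)

(* Defs.v *)
From HB Require Import structures.
From mathcomp Require Import all_boot all_order all_algebra.
From mathcomp Require Import generic_quotient.
From mathcomp Require Import boolp.

Set Implicit Arguments.
Unset Strict Implicit.
Unset Printing Implicit Defensive.

Import GRing.Theory.
Local Open Scope ring_scope.
Local Open Scope quotient_scope.

(* The bracket is required to be alternating, not merely antisymmetric:
   characteristic 2 is allowed. *)
HB.mixin Record Lmodule_isLie (k : fieldType) g of GRing.Lmodule k g := {
  lie : g -> g -> g;
  lie_linearl : forall y, linear (fun x => lie x y);
  lie_linearr : forall x, linear (lie x);
  liexx : forall x, lie x x = 0;
  jacobi : forall x y z,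
    lie x (lie y z) + lie y (lie z x) + lie z (lie x y) = 0
}.

#[short(type="lieAlgType")]
HB.structure Definition LieAlgebra (k : fieldType) :=
  { g of GRing.Lmodule k g & Lmodule_isLie k g }.

HB.mixin Record Lie_isPostLie (k : fieldType) g of LieAlgebra k g := {
  rhd : g -> g -> g;
  rhd_linearl : forall y, linear (fun x => rhd x y);
  rhd_linearr : forall x, linear (rhd x);
  rhd_lie : forall x y z,
    rhd x (lie y z) = lie (rhd x y) z + lie y (rhd x z);
  lie_rhd : forall x y z,
    rhd (lie x y + rhd x y - rhd y x) z = rhd x (rhd y z) - rhd y (rhd x z)
}.

#[short(type="postLieAlgType")]
HB.structure Definition PostLieAlgebra (k : fieldType) :=
  { g of LieAlgebra k g & Lie_isPostLie k g }.

(* The universal enveloping algebra as the unital associative k-algebra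
   presented by the generators [UGen x], for x in g, and the relations making
   UGen linear and sending the bracket to the commutator. [ueq] is the
   congruence generated by these relations and the axioms of k-algebras. *)
Section UniversalEnvelopingAlgebra.
Variables (k : fieldType) (g : lieAlgType k).

Inductive uterm : Type :=
| UGen of g
| UZero
| UOne
| UOpp of uterm
| UAdd of uterm & uterm
| UMul of uterm & uterm
| UScale of k & uterm.

Inductive ueq : uterm -> uterm -> Prop :=
| ueq_refl s : ueq s s
| ueq_sym s t : ueq s t -> ueq t s
| ueq_trans s t u : ueq s t -> ueq t u -> ueq s u
| ueq_opp s s' : ueq s s' -> ueq (UOpp s) (UOpp s')
| ueq_add s s' t t' : ueq s s' -> ueq t t' -> ueq (UAdd s t) (UAdd s' t')
| ueq_mul s s' t t' : ueq s s' -> ueq t t' -> ueq (UMul s t) (UMul s' t')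
| ueq_scale a s s' : ueq s s' -> ueq (UScale a s) (UScale a s')
| ueq_addA s t u : ueq (UAdd s (UAdd t u)) (UAdd (UAdd s t) u)
| ueq_addC s t : ueq (UAdd s t) (UAdd t s)
| ueq_add0 s : ueq (UAdd UZero s) s
| ueq_addN s : ueq (UAdd (UOpp s) s) UZero
| ueq_mulA s t u : ueq (UMul s (UMul t u)) (UMul (UMul s t) u)
| ueq_mul1l s : ueq (UMul UOne s) s
| ueq_mul1r s : ueq (UMul s UOne) s
| ueq_mulDl s t u : ueq (UMul (UAdd s t) u) (UAdd (UMul s u) (UMul t u))
| ueq_mulDr s t u : ueq (UMul s (UAdd t u)) (UAdd (UMul s t) (UMul s u))
| ueq_scaleA a b s : ueq (UScale a (UScale b s)) (UScale (a * b) s)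
| ueq_scale1 s : ueq (UScale 1 s) s
| ueq_scaleDr a s t :
    ueq (UScale a (UAdd s t)) (UAdd (UScale a s) (UScale a t))
| ueq_scaleDl a b s :
    ueq (UScale (a + b) s) (UAdd (UScale a s) (UScale b s))
| ueq_scaleAl a s t : ueq (UScale a (UMul s t)) (UMul (UScale a s) t)
| ueq_scaleAr a s t : ueq (UScale a (UMul s t)) (UMul s (UScale a t))
| ueq_gen a x y : ueq (UGen (a *: x + y)) (UAdd (UScale a (UGen x)) (UGen y))
| ueq_lie x y : ueq (UGen (lie x y))
    (UAdd (UMul (UGen x) (UGen y)) (UOpp (UMul (UGen y) (UGen x)))).

HB.instance Definition _ := gen_eqMixin uterm.
HB.instance Definition _ := gen_choiceMixin uterm.

Definition ueqb (s t : uterm) : bool := `[< ueq s t >].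

Lemma ueqb_is_equiv : equiv_class_of ueqb.
Proof.
split.
- by move=> s; apply/asboolP/ueq_refl.
- by move=> s t; apply/idP/idP => /asboolP h; apply/asboolP/ueq_sym.
- by move=> t s u /asboolP h1 /asboolP h2; apply/asboolP/(ueq_trans h1 h2).
Qed.

Canonical ueqb_equiv := EquivRelPack ueqb_is_equiv.

Definition uea := {eq_quot ueqb}.
HB.instance Definition _ := Choice.on uea.
HB.instance Definition _ := EqQuotient.on uea.

Definition uclass (s : uterm) : uea := \pi s.

Lemma uW (P : uea -> Prop) : (forall s, P (uclass s)) -> forall x, P x.
Proof. by move=> h; elim/quotW. Qed.

Lemma upiP (s t : uterm) : ueq s t <-> uclass s = uclass t.
Proof.
by split=> [h|/eqmodP/asboolP //]; apply/eqmodP/asboolP.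
Qed.

Lemma urepr (s : uterm) : ueq (repr (uclass s)) s.
Proof. by apply/upiP; exact: reprK. Qed.

Definition uea_zero : uea := uclass UZero.
Definition uea_one : uea := uclass UOne.
Definition uea_opp : uea -> uea :=
  locked (fun x => uclass (UOpp (repr x))).
Definition uea_add : uea -> uea -> uea :=
  locked (fun x y => uclass (UAdd (repr x) (repr y))).
Definition uea_mul : uea -> uea -> uea :=
  locked (fun x y => uclass (UMul (repr x) (repr y))).
Definition uea_scale : k -> uea -> uea :=
  locked (fun a x => uclass (UScale a (repr x))).

Lemma uea_oppE s : uea_opp (uclass s) = uclass (UOpp s).
Proof. by rewrite /uea_opp -lock; apply/upiP/ueq_opp/urepr. Qed.
Lemma uea_addE s t : uea_add (uclass s) (uclass t) = uclass (UAdd s t).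
Proof. by rewrite /uea_add -lock; apply/upiP/ueq_add; apply/urepr. Qed.
Lemma uea_mulE s t : uea_mul (uclass s) (uclass t) = uclass (UMul s t).
Proof. by rewrite /uea_mul -lock; apply/upiP/ueq_mul; apply/urepr. Qed.
Lemma uea_scaleE a s : uea_scale a (uclass s) = uclass (UScale a s).
Proof. by rewrite /uea_scale -lock; apply/upiP/ueq_scale/urepr. Qed.

Local Notation opE := (uea_oppE, uea_addE, uea_mulE, uea_scaleE).

Lemma uea_addA : associative uea_add.
Proof.
by elim/uW=> s; elim/uW=> t; elim/uW=> u; rewrite !opE; apply/upiP/ueq_addA.
Qed.
Lemma uea_addC : commutative uea_add.
Proof. by elim/uW=> s; elim/uW=> t; rewrite !opE; apply/upiP/ueq_addC. Qed.
Lemma uea_add0 : left_id uea_zero uea_add.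
Proof. by elim/uW=> s; rewrite !opE; apply/upiP/ueq_add0. Qed.
Lemma uea_addN : left_inverse uea_zero uea_opp uea_add.
Proof. by elim/uW=> s; rewrite !opE; apply/upiP/ueq_addN. Qed.

HB.instance Definition _ :=
  GRing.isZmodule.Build uea uea_addA uea_addC uea_add0 uea_addN.

Lemma uea_mulA : associative uea_mul.
Proof.
by elim/uW=> s; elim/uW=> t; elim/uW=> u; rewrite !opE; apply/upiP/ueq_mulA.
Qed.
Lemma uea_mul1l : left_id uea_one uea_mul.
Proof. by elim/uW=> s; rewrite !opE; apply/upiP/ueq_mul1l. Qed.
Lemma uea_mul1r : right_id uea_one uea_mul.
Proof. by elim/uW=> s; rewrite !opE; apply/upiP/ueq_mul1r. Qed.
Lemma uea_mulDl : left_distributive uea_mul uea_add.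
Proof.
by elim/uW=> s; elim/uW=> t; elim/uW=> u; rewrite !opE; apply/upiP/ueq_mulDl.
Qed.
Lemma uea_mulDr : right_distributive uea_mul uea_add.
Proof.
by elim/uW=> s; elim/uW=> t; elim/uW=> u; rewrite !opE; apply/upiP/ueq_mulDr.
Qed.

Section Lift.
Variables (A : algType k) (f : g -> A).

Fixpoint ueval (s : uterm) : A :=
  match s with
  | UGen x => f x
  | UZero => 0
  | UOne => 1
  | UOpp s => - ueval s
  | UAdd s t => ueval s + ueval t
  | UMul s t => ueval s * ueval t
  | UScale a s => a *: ueval s
  end.

Definition uea_lift (x : uea) : A := ueval (repr x).

Hypothesis f_linear : linear f.
Hypothesis f_lie : forall x y, f (lie x y) = f x * f y - f y * f x.

Lemma ueval_ueq s t : ueq s t -> ueval s = ueval t.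
Proof.
elim=> //= {s t}.
- by move=> s t u _ -> _ ->.
- by move=> s s' _ ->.
- by move=> s s' t t' _ -> _ ->.
- by move=> s s' t t' _ -> _ ->.
- by move=> a s s' _ ->.
- by move=> s t u; rewrite addrA.
- by move=> s t; rewrite addrC.
- by move=> s; rewrite add0r.
- by move=> s; rewrite addNr.
- by move=> s t u; rewrite mulrA.
- by move=> s; rewrite mul1r.
- by move=> s; rewrite mulr1.
- by move=> s t u; rewrite mulrDl.
- by move=> s t u; rewrite mulrDr.
- by move=> a b s; rewrite scalerA.
- by move=> s; rewrite scale1r.
- by move=> a s t; rewrite scalerDr.
- by move=> a b s; rewrite scalerDl.
- by move=> a s t; rewrite scalerAl.
- by move=> a s t; rewrite scalerAr.
Qed.

Lemma uea_liftE s : uea_lift (uclass s) = ueval s.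
Proof. exact/ueval_ueq/urepr. Qed.

End Lift.

Lemma uea_one_neq0 : uea_one != uea_zero.
Proof.
apply/eqP=> /upiP/(@ueval_ueq k^o (fun=> 0)) /=.
have l0 : linear (fun _ : g => 0 : k^o) by move=> a x y; rewrite scaler0 addr0.
have b0 : g -> g -> 0 = 0 * 0 - 0 * 0 :> k^o by move=> _ _; rewrite mul0r subr0.
by move=> /(_ l0 b0)/eqP; rewrite oner_eq0.
Qed.

HB.instance Definition _ := GRing.Zmodule_isNzRing.Build uea
  uea_mulA uea_mul1l uea_mul1r uea_mulDl uea_mulDr uea_one_neq0.

Lemma uea_scaleA a b (x : uea) :
  uea_scale a (uea_scale b x) = uea_scale (a * b) x.
Proof. by elim/uW: x => s; rewrite !opE; apply/upiP/ueq_scaleA. Qed.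
Lemma uea_scale1 : left_id 1 uea_scale.
Proof. by elim/uW=> s; rewrite !opE; apply/upiP/ueq_scale1. Qed.
Lemma uea_scaleDr : right_distributive uea_scale +%R.
Proof.
move=> a; elim/uW=> s; elim/uW=> t; rewrite -[_ + _]/(uea_add _ _).
by rewrite -[X in _ = X]/(uea_add _ _) !opE; apply/upiP/ueq_scaleDr.
Qed.
Lemma uea_scaleDl x : {morph uea_scale^~ x : a b / a + b}.
Proof.
elim/uW: x => s a b.
by rewrite -[X in _ = X]/(uea_add _ _) !opE; apply/upiP/ueq_scaleDl.
Qed.

HB.instance Definition _ := GRing.Zmodule_isLmodule.Build k uea
  uea_scaleA uea_scale1 uea_scaleDr uea_scaleDl.

Lemma uea_scaleAl (a : k) (x y : uea) : a *: (x * y) = (a *: x) * y.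
Proof.
elim/uW: x => s; elim/uW: y => t.
rewrite -[LHS]/(uea_scale _ (uea_mul _ _)).
by rewrite -[RHS]/(uea_mul (uea_scale _ _) _) !opE; apply/upiP/ueq_scaleAl.
Qed.

HB.instance Definition _ := GRing.Lmodule_isLalgebra.Build k uea uea_scaleAl.

Lemma uea_scaleAr (a : k) (x y : uea) : a *: (x * y) = x * (a *: y).
Proof.
elim/uW: x => s; elim/uW: y => t.
rewrite -[LHS]/(uea_scale _ (uea_mul _ _)).
by rewrite -[RHS]/(uea_mul _ (uea_scale _ _)) !opE; apply/upiP/ueq_scaleAr.
Qed.

HB.instance Definition _ := GRing.Lalgebra_isAlgebra.Build k uea uea_scaleAr.

Definition uea_in (x : g) : uea := uclass (UGen x).

Lemma uea_in_linear : linear uea_in.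
Proof.
move=> a x y; rewrite -[RHS]/(uea_add (uea_scale _ _) _) /uea_in !opE.
exact/upiP/ueq_gen.
Qed.

Lemma uea_in_lie x y :
  uea_in (lie x y) = uea_in x * uea_in y - uea_in y * uea_in x.
Proof.
rewrite -[RHS]/(uea_add (uea_mul _ _) (uea_opp (uea_mul _ _))) /uea_in !opE.
exact/upiP/ueq_lie.
Qed.

Lemma uea_ind (P : uea -> Prop) :
  (forall x, P (uea_in x)) -> P 1 ->
  (forall x y, P x -> P y -> P (x + y)) ->
  (forall x y, P x -> P y -> P (x * y)) ->
  (forall a x, P x -> P (a *: x)) -> forall x, P x.
Proof.
move=> Pin P1 PD PM PZ; elim/uW; elim=> //.
- by rewrite -[uclass _]/(0 : uea) -(scale0r (1 : uea)); apply: PZ.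
- move=> s Ps; rewrite -uea_oppE -[uea_opp _]/(- (uclass s : uea)) -scaleN1r.
  exact: PZ.
- by move=> s Ps t Pt; rewrite -uea_addE; apply: PD.
- by move=> s Ps t Pt; rewrite -uea_mulE; apply: PM.
- by move=> a s Ps; rewrite -uea_scaleE; apply: PZ.
Qed.

Section UniversalProperty.
Variables (A : algType k) (f : g -> A).
Hypothesis f_linear : linear f.
Hypothesis f_lie : forall x y, f (lie x y) = f x * f y - f y * f x.

Local Notation liftE := (uea_liftE f_linear f_lie).

Lemma uea_lift_in x : uea_lift f (uea_in x) = f x.
Proof. by rewrite liftE. Qed.

Lemma uea_lift1 : uea_lift f 1 = 1.
Proof. by rewrite [LHS]liftE. Qed.

Lemma uea_liftD x y : uea_lift f (x + y) = uea_lift f x + uea_lift f y.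
Proof.
by elim/uW: x => s; elim/uW: y => t; rewrite [_ + _]uea_addE !liftE.
Qed.

Lemma uea_liftM x y : uea_lift f (x * y) = uea_lift f x * uea_lift f y.
Proof.
by elim/uW: x => s; elim/uW: y => t; rewrite [_ * _]uea_mulE !liftE.
Qed.

Lemma uea_liftZ a x : uea_lift f (a *: x) = a *: uea_lift f x.
Proof. by elim/uW: x => s; rewrite [_ *: _]uea_scaleE !liftE. Qed.

Lemma uea_lift_uniq (h : {lrmorphism uea -> A}) :
  (forall x, h (uea_in x) = f x) -> h =1 uea_lift f.
Proof.
move=> hf; elim/uea_ind => [x||x y IHx IHy|x y IHx IHy|a x IHx].
- by rewrite hf uea_lift_in.
- by rewrite rmorph1 uea_lift1.
- by rewrite rmorphD uea_liftD -IHx -IHy.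
- by rewrite rmorphM uea_liftM -IHx -IHy.
- by rewrite linearZ uea_liftZ -IHx.
Qed.

End UniversalProperty.
End UniversalEnvelopingAlgebra.

Arguments uea_in {k g} x.

(* The tensor product over k of two (possibly infinite-dimensional) vector
   spaces, presented by generators and relations in the same way. *)
Section TensorProduct.
Variables (k : fieldType) (V W : lmodType k).

Inductive tterm : Type :=
| TPure of V & W
| TZero
| TOpp of tterm
| TAdd of tterm & tterm
| TScale of k & tterm.

Inductive teq : tterm -> tterm -> Prop :=
| teq_refl s : teq s s
| teq_sym s t : teq s t -> teq t s
| teq_trans s t u : teq s t -> teq t u -> teq s u
| teq_opp s s' : teq s s' -> teq (TOpp s) (TOpp s')
| teq_add s s' t t' : teq s s' -> teq t t' -> teq (TAdd s t) (TAdd s' t')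
| teq_scale a s s' : teq s s' -> teq (TScale a s) (TScale a s')
| teq_addA s t u : teq (TAdd s (TAdd t u)) (TAdd (TAdd s t) u)
| teq_addC s t : teq (TAdd s t) (TAdd t s)
| teq_add0 s : teq (TAdd TZero s) s
| teq_addN s : teq (TAdd (TOpp s) s) TZero
| teq_scaleA a b s : teq (TScale a (TScale b s)) (TScale (a * b) s)
| teq_scale1 s : teq (TScale 1 s) s
| teq_scaleDr a s t :
    teq (TScale a (TAdd s t)) (TAdd (TScale a s) (TScale a t))
| teq_scaleDl a b s :
    teq (TScale (a + b) s) (TAdd (TScale a s) (TScale b s))
| teq_linearl a v v' w :
    teq (TPure (a *: v + v') w) (TAdd (TScale a (TPure v w)) (TPure v' w))
| teq_linearr a v w w' :
    teq (TPure v (a *: w + w')) (TAdd (TScale a (TPure v w)) (TPure v w')).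

HB.instance Definition _ := gen_eqMixin tterm.
HB.instance Definition _ := gen_choiceMixin tterm.

Definition teqb (s t : tterm) : bool := `[< teq s t >].

Lemma teqb_is_equiv : equiv_class_of teqb.
Proof.
split.
- by move=> s; apply/asboolP/teq_refl.
- by move=> s t; apply/idP/idP => /asboolP h; apply/asboolP/teq_sym.
- by move=> t s u /asboolP h1 /asboolP h2; apply/asboolP/(teq_trans h1 h2).
Qed.

Canonical teqb_equiv := EquivRelPack teqb_is_equiv.

Definition tensor := {eq_quot teqb}.
HB.instance Definition _ := Choice.on tensor.
HB.instance Definition _ := EqQuotient.on tensor.

Definition tclass (s : tterm) : tensor := \pi s.

Lemma tW (P : tensor -> Prop) : (forall s, P (tclass s)) -> forall x, P x.
Proof. by move=> h; elim/quotW. Qed.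

Lemma tpiP (s t : tterm) : teq s t <-> tclass s = tclass t.
Proof.
by split=> [h|/eqmodP/asboolP //]; apply/eqmodP/asboolP.
Qed.

Lemma trepr (s : tterm) : teq (repr (tclass s)) s.
Proof. by apply/tpiP; exact: reprK. Qed.

Definition tensor_zero : tensor := tclass TZero.
Definition tensor_opp : tensor -> tensor :=
  locked (fun x => tclass (TOpp (repr x))).
Definition tensor_add : tensor -> tensor -> tensor :=
  locked (fun x y => tclass (TAdd (repr x) (repr y))).
Definition tensor_scale : k -> tensor -> tensor :=
  locked (fun a x => tclass (TScale a (repr x))).

Lemma tensor_oppE s : tensor_opp (tclass s) = tclass (TOpp s).
Proof. by rewrite /tensor_opp -lock; apply/tpiP/teq_opp/trepr. Qed.
Lemma tensor_addE s t : tensor_add (tclass s) (tclass t) = tclass (TAdd s t).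
Proof. by rewrite /tensor_add -lock; apply/tpiP/teq_add; apply/trepr. Qed.
Lemma tensor_scaleE a s : tensor_scale a (tclass s) = tclass (TScale a s).
Proof. by rewrite /tensor_scale -lock; apply/tpiP/teq_scale/trepr. Qed.

Local Notation opE := (tensor_oppE, tensor_addE, tensor_scaleE).

Lemma tensor_addA : associative tensor_add.
Proof.
by elim/tW=> s; elim/tW=> t; elim/tW=> u; rewrite !opE; apply/tpiP/teq_addA.
Qed.
Lemma tensor_addC : commutative tensor_add.
Proof. by elim/tW=> s; elim/tW=> t; rewrite !opE; apply/tpiP/teq_addC. Qed.
Lemma tensor_add0 : left_id tensor_zero tensor_add.
Proof. by elim/tW=> s; rewrite !opE; apply/tpiP/teq_add0. Qed.
Lemma tensor_addN : left_inverse tensor_zero tensor_opp tensor_add.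
Proof. by elim/tW=> s; rewrite !opE; apply/tpiP/teq_addN. Qed.

HB.instance Definition _ :=
  GRing.isZmodule.Build tensor tensor_addA tensor_addC tensor_add0 tensor_addN.

Lemma tensor_scaleA a b (x : tensor) :
  tensor_scale a (tensor_scale b x) = tensor_scale (a * b) x.
Proof. by elim/tW: x => s; rewrite !opE; apply/tpiP/teq_scaleA. Qed.
Lemma tensor_scale1 : left_id 1 tensor_scale.
Proof. by elim/tW=> s; rewrite !opE; apply/tpiP/teq_scale1. Qed.
Lemma tensor_scaleDr : right_distributive tensor_scale +%R.
Proof.
move=> a; elim/tW=> s; elim/tW=> t; rewrite -[_ + _]/(tensor_add _ _).
by rewrite -[X in _ = X]/(tensor_add _ _) !opE; apply/tpiP/teq_scaleDr.
Qed.
Lemma tensor_scaleDl x : {morph tensor_scale^~ x : a b / a + b}.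
Proof.
elim/tW: x => s a b.
by rewrite -[X in _ = X]/(tensor_add _ _) !opE; apply/tpiP/teq_scaleDl.
Qed.

HB.instance Definition _ := GRing.Zmodule_isLmodule.Build k tensor
  tensor_scaleA tensor_scale1 tensor_scaleDr tensor_scaleDl.

Definition pure (v : V) (w : W) : tensor := tclass (TPure v w).

Lemma pure_linearl w : linear (fun v => pure v w).
Proof.
move=> a v v'; rewrite -[RHS]/(tensor_add (tensor_scale _ _) _) /pure !opE.
exact/tpiP/teq_linearl.
Qed.

Lemma pure_linearr v : linear (pure v).
Proof.
move=> a w w'; rewrite -[RHS]/(tensor_add (tensor_scale _ _) _) /pure !opE.
exact/tpiP/teq_linearr.
Qed.

HB.instance Definition _ v := GRing.isLinear.Build k W tensor _ (pure v)
  (pure_linearr v).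

Lemma pureDl v v' w : pure (v + v') w = pure v w + pure v' w.
Proof. by have := pure_linearl w 1 v v'; rewrite !scale1r. Qed.

Lemma pure0l w : pure 0 w = 0.
Proof. by apply: (addrI (pure 0 w)); rewrite -pureDl !addr0. Qed.

Lemma pureZl a v w : pure (a *: v) w = a *: pure v w.
Proof. by have := pure_linearl w a v 0; rewrite pure0l !addr0. Qed.

Lemma pureDr v w w' : pure v (w + w') = pure v w + pure v w'.
Proof. exact: raddfD. Qed.

Lemma pureZr a v w : pure v (a *: w) = a *: pure v w.
Proof. exact: linearZ. Qed.

Lemma tensor_ind (P : tensor -> Prop) :
  (forall v w, P (pure v w)) -> (forall s t, P s -> P t -> P (s + t)) ->
  forall t, P t.
Proof.
move=> Pp PD.
suff PZ (s : tterm) a : P (a *: (tclass s : tensor)).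
  by elim/tW=> s; rewrite -[tclass s]scale1r; apply: PZ.
elim: s a => [v w||s Ps|s Ps t Pt|b s Ps] a.
- by rewrite -[tclass _]/(pure v w) -pureZl.
- by rewrite -[tclass _]/(0 : tensor) scaler0 -(pure0l 0).
- by rewrite -tensor_oppE [X in P X]scalerN -scaleNr.
- by rewrite -tensor_addE [X in P X]scalerDr; apply: PD.
- by rewrite -tensor_scaleE [X in P X]scalerA.
Qed.

Lemma tensor_sum_pure (t : tensor) :
  exists s : seq (V * W), t = \sum_(i <- s) pure i.1 i.2.
Proof.
elim/tensor_ind: t => [v w|t u [r ->] [s ->]].
  by exists [:: (v, w)]; rewrite big_seq1.
by exists (r ++ s); rewrite big_cat.
Qed.

Section Lift.
Variables (X : lmodType k) (B : V -> W -> X).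

Fixpoint teval (s : tterm) : X :=
  match s with
  | TPure v w => B v w
  | TZero => 0
  | TOpp s => - teval s
  | TAdd s t => teval s + teval t
  | TScale a s => a *: teval s
  end.

Definition tensor_lift (x : tensor) : X := teval (repr x).

Hypothesis B_linearl : forall w, linear (fun v => B v w).
Hypothesis B_linearr : forall v, linear (B v).

Lemma teval_teq s t : teq s t -> teval s = teval t.
Proof.
elim=> //= {s t}.
- by move=> s t u _ -> _ ->.
- by move=> s s' _ ->.
- by move=> s s' t t' _ -> _ ->.
- by move=> a s s' _ ->.
- by move=> s t u; rewrite addrA.
- by move=> s t; rewrite addrC.
- by move=> s; rewrite add0r.
- by move=> s; rewrite addNr.
- by move=> a b s; rewrite scalerA.
- by move=> s; rewrite scale1r.
- by move=> a s t; rewrite scalerDr.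
- by move=> a b s; rewrite scalerDl.
- by move=> a v v' w; rewrite B_linearl.
- by move=> a v w w'; rewrite B_linearr.
Qed.

Lemma tensor_liftE s : tensor_lift (tclass s) = teval s.
Proof. exact/teval_teq/trepr. Qed.

Lemma tensor_lift_pure v w : tensor_lift (pure v w) = B v w.
Proof. by rewrite [LHS]tensor_liftE. Qed.

Lemma tensor_lift_linear : linear tensor_lift.
Proof.
move=> a; elim/tW=> s; elim/tW=> t.
by rewrite [_ *: _]tensor_scaleE [_ + _]tensor_addE !tensor_liftE.
Qed.

Lemma tensor_liftD s t : tensor_lift (s + t) = tensor_lift s + tensor_lift t.
Proof. by have := tensor_lift_linear 1 s t; rewrite !scale1r. Qed.

End Lift.
End TensorProduct.

Arguments pure {k V W} v w.

(* The algebra structure on the tensor product of two algebras, with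
   (a (x) b) (c (x) d) = (a c) (x) (b d). *)
Section TensorAlgebra.
Variables (k : fieldType) (A B : algType k).
Local Notation T := (tensor A B).

Definition tmul_pure (t : T) (a : A) (b : B) : T :=
  tensor_lift (fun c d => pure (a * c) (b * d)) t.

Lemma tmul_pure_linear a b : linear (fun t => tmul_pure t a b).
Proof.
apply: tensor_lift_linear => [d|c] x u v.
  by rewrite mulrDr -scalerAr pure_linearl.
by rewrite mulrDr -scalerAr pure_linearr.
Qed.

Lemma tmul_pureE a b c d : tmul_pure (pure c d) a b = pure (a * c) (b * d).
Proof.
apply: tensor_lift_pure => [d'|c'] x u v.
  by rewrite mulrDr -scalerAr pure_linearl.
by rewrite mulrDr -scalerAr pure_linearr.
Qed.

Lemma tmul_pureD s t a b : tmul_pure (s + t) a b = tmul_pure s a b + tmul_pure t a b.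
Proof. by have := tmul_pure_linear a b 1 s t; rewrite !scale1r. Qed.

Lemma tmul_pure_linearl t b : linear (fun a => tmul_pure t a b).
Proof.
elim/tensor_ind: t => [c d|s t IHs IHt] x u v.
  by rewrite !tmul_pureE mulrDl -scalerAl pure_linearl.
by rewrite !tmul_pureD IHs IHt scalerDr addrACA.
Qed.

Lemma tmul_pure_linearr t a : linear (tmul_pure t a).
Proof.
elim/tensor_ind: t => [c d|s t IHs IHt] x u v.
  by rewrite !tmul_pureE mulrDl -scalerAl pure_linearr.
by rewrite !tmul_pureD IHs IHt scalerDr addrACA.
Qed.

Definition tmul (s t : T) : T := tensor_lift (tmul_pure t) s.

Lemma tmul_linearl t : linear (fun s => tmul s t).
Proof.
apply: tensor_lift_linear; first exact: tmul_pure_linearl.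
exact: tmul_pure_linearr.
Qed.

Lemma tmul_purel a b t : tmul (pure a b) t = tmul_pure t a b.
Proof.
apply: tensor_lift_pure; first exact: tmul_pure_linearl.
exact: tmul_pure_linearr.
Qed.

Lemma tmulE a b c d : tmul (pure a b) (pure c d) = pure (a * c) (b * d).
Proof. by rewrite tmul_purel tmul_pureE. Qed.

Lemma tmulDl : left_distributive tmul +%R.
Proof. by move=> s t u; have := tmul_linearl u 1 s t; rewrite !scale1r. Qed.

Lemma tmulDr : right_distributive tmul +%R.
Proof.
move=> s t u; elim/tensor_ind: s => [a b|s s' IH IH'].
  by rewrite !tmul_purel tmul_pureD.
by rewrite !tmulDl IH IH' addrACA.
Qed.

Lemma tmulA : associative tmul.
Proof.
move=> s t u; elim/tensor_ind: s => [a b|s s' IH IH']; last first.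
  by rewrite !tmulDl IH IH'.
elim/tensor_ind: t => [c d|t t' IH IH']; last first.
  by rewrite !(tmulDl, tmulDr) IH IH'.
elim/tensor_ind: u => [e f|u u' IH IH']; last first.
  by rewrite !tmulDr IH IH'.
by rewrite !tmulE !mulrA.
Qed.

Lemma tmul1l : left_id (pure 1 1) tmul.
Proof.
by elim/tensor_ind=> [a b|s t IHs IHt]; rewrite ?tmulE ?mul1r // tmulDr IHs IHt.
Qed.

Lemma tmul1r : right_id (pure 1 1) tmul.
Proof.
by elim/tensor_ind=> [a b|s t IHs IHt]; rewrite ?tmulE ?mulr1 // tmulDl IHs IHt.
Qed.

HB.instance Definition _ := GRing.Zmodule_isPzRing.Build T
  tmulA tmul1l tmul1r tmulDl tmulDr.

Lemma pureM (a c : A) (b d : B) : pure a b * pure c d = pure (a * c) (b * d).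
Proof. exact: tmulE. Qed.

Lemma tensor_scaleAl (x : k) (s t : T) : x *: (s * t) = (x *: s) * t.
Proof.
by have /esym := tmul_linearl t x s 0; rewrite -[tmul 0 t]/(0 * t) mul0r !addr0.
Qed.

Lemma tensor_scaleAr (x : k) (s t : T) : x *: (s * t) = s * (x *: t).
Proof.
elim/tensor_ind: s => [a b|s s' IH IH']; last first.
  by rewrite !mulrDl scalerDr IH IH'.
elim/tensor_ind: t => [c d|t t' IH IH']; last first.
  by rewrite scalerDr !mulrDr scalerDr IH IH'.
by rewrite -pureZl !pureM -pureZl -scalerAr.
Qed.

End TensorAlgebra.

Section HopfStructure.
Variables (k : fieldType) (g : lieAlgType k).
Local Notation U := (uea g).

Definition counit : U -> k := uea_lift (A := k^o) (fun=> 0).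

Lemma counit_in_linear : linear (fun _ : g => 0 : k^o).
Proof. by move=> a x y; rewrite scaler0 addr0. Qed.

Lemma counit_in_lie : g -> g -> 0 = 0 * 0 - 0 * 0 :> k^o.
Proof. by move=> _ _; rewrite mul0r subr0. Qed.

Local Notation cl := counit_in_linear.
Local Notation cb := counit_in_lie.

Lemma counit_in x : counit (uea_in x) = 0. Proof. exact: uea_lift_in cl cb x. Qed.
Lemma counit1 : counit 1 = 1. Proof. exact: uea_lift1 cl cb. Qed.
Lemma counitD x y : counit (x + y) = counit x + counit y.
Proof. exact: uea_liftD cl cb x y. Qed.
Lemma counitM x y : counit (x * y) = counit x * counit y.
Proof. exact: uea_liftM cl cb x y. Qed.
Lemma counitZ a x : counit (a *: x) = a * counit x.
Proof. exact: uea_liftZ cl cb a x. Qed.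

Lemma tensor_uea_neq0 : (1 : tensor U U) != 0.
Proof.
pose F (x y : U) : k^o := counit x * counit y.
have Fl y : linear (fun x => F x y).
  by move=> a u v; rewrite /F counitD counitZ mulrDl -mulrA.
have Fr x : linear (F x).
  by move=> a u v; rewrite /F counitD counitZ mulrDr mulrCA.
apply/eqP => /(congr1 (tensor_lift F)).
rewrite [LHS](tensor_lift_pure Fl Fr) -(pure0l U 0) (tensor_lift_pure Fl Fr).
rewrite /F !counit1 -(scale0r (1 : U)) counitZ !mul0r mulr1 => /eqP.
by rewrite oner_eq0.
Qed.

HB.instance Definition _ :=
  GRing.PzSemiRing_isNonZero.Build (tensor U U) tensor_uea_neq0.
HB.instance Definition _ :=
  GRing.Lmodule_isLalgebra.Build k (tensor U U) (@tensor_scaleAl k U U).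
HB.instance Definition _ :=
  GRing.Lalgebra_isAlgebra.Build k (tensor U U) (@tensor_scaleAr k U U).

Definition coprod_in (x : g) : tensor U U :=
  pure (uea_in x) 1 + pure 1 (uea_in x).

Definition coprod : U -> tensor U U := uea_lift coprod_in.

Lemma coprod_in_linear : linear coprod_in.
Proof.
move=> a x y.
by rewrite /coprod_in uea_in_linear pure_linearl linearP scalerDr addrACA.
Qed.

Lemma coprod_in_lie x y :
  coprod_in (lie x y) = coprod_in x * coprod_in y - coprod_in y * coprod_in x.
Proof.
rewrite /coprod_in uea_in_lie pureDl pureDr raddfN /=.
rewrite -[- (_ * _)]scaleN1r pureZl scaleN1r.
rewrite !mulrDl !mulrDr !pureM !(mulr1, mul1r).
rewrite !opprD [RHS](AC ((2*2)*(2*2)) ((1*5)*(4*8)*((2*7)*(3*6)))) /=.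
by rewrite !subrr !addr0.
Qed.

Local Notation dl := coprod_in_linear.
Local Notation db := coprod_in_lie.

Lemma coprod_gen x : coprod (uea_in x) = pure (uea_in x) 1 + pure 1 (uea_in x).
Proof. exact: uea_lift_in dl db x. Qed.
Lemma coprod1 : coprod 1 = 1. Proof. exact: uea_lift1 dl db. Qed.
Lemma coprodD x y : coprod (x + y) = coprod x + coprod y.
Proof. exact: uea_liftD dl db x y. Qed.
Lemma coprodM x y : coprod (x * y) = coprod x * coprod y.
Proof. exact: uea_liftM dl db x y. Qed.
Lemma coprodZ a x : coprod (a *: x) = a *: coprod x.
Proof. exact: uea_liftZ dl db a x. Qed.

(* [sweedler x s]: the list s of pairs (x_1, x_2) is an expansion of the
   coproduct of x as a finite sum of pure tensors. Every x has one by
   [tensor_sum_pure]. *)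
Definition sweedler (x : U) (s : seq (U * U)) : Prop :=
  coprod x = \sum_(i <- s) pure i.1 i.2.

End HopfStructure.

(* In the fields below the sums range over arbitrary Sweedler expansions; as R
   is bilinear, their values do not depend on the expansion chosen. *)
Record guin_oudom (k : fieldType) (g : postLieAlgType k)
    (R : uea g -> uea g -> uea g) : Prop := GuinOudom {
  go_linearl : forall y, linear (fun x => R x y);
  go_linearr : forall x, linear (R x);
  go_extends : forall x y : g, R (uea_in x) (uea_in y) = uea_in (rhd x y);
  go_coprod : forall x y s t, sweedler x s -> sweedler y t ->
    coprod (R x y) = \sum_(i <- s) \sum_(j <- t) pure (R i.1 j.1) (R i.2 j.2);
  go_counit : forall x y, counit (R x y) = counit x * counit y;
  go_1l : forall z, R 1 z = z;
  go_1r : forall x, R x 1 = counit x *: 1;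
  go_mul : forall x y z s, sweedler x s ->
    R x (y * z) = \sum_(i <- s) R i.1 y * R i.2 z;
  go_assoc : forall x y z s, sweedler x s ->
    R x (R y z) = R (\sum_(i <- s) i.1 * R i.2 y) z
}.

(* The space g^(p), spanned by the p^n-th powers in U(g) of the elements of g. *)
Definition pspan (k : fieldType) (g : lieAlgType k) (p : nat) (z : uea g) : Prop :=
  exists s : seq (k * (g * nat)),
    z = \sum_(i <- s) i.1 *: uea_in i.2.1 ^+ (p ^ i.2.2).

Definition commutator (A : pzRingType) (x y : A) : A := x * y - y * x.

(* Main.v *)
Require Import Defs.
From mathcomp Require Import all_boot all_order all_algebra.

(** Elements of g^(p) are primitive, because the Frobenius map is additive on
    the commuting elements x (x) 1 and 1 (x) x; hence rhdU y is a derivation and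
    it maps x^p to the sum of the x^(p-1-i) * rhdU y x * x^i. In characteristic
    p the binomial coefficient of (p-1, i) is (-1)^i, so that sum is the
    expansion of the (p-1)-st power of ad x = L_x - R_x. *)

Set Implicit Arguments.
Unset Strict Implicit.
Unset Printing Implicit Defensive.

Import GRing.Theory.
Local Open Scope ring_scope.

Section RingLemmas.
Variables (A : nzRingType) (p : nat).
Hypothesis char_A : p \in [pchar A].

Lemma exprD_pexp_comm (x y : A) n : GRing.comm x y ->
  (x + y) ^+ (p ^ n) = x ^+ (p ^ n) + y ^+ (p ^ n).
Proof.
move=> cxy; elim: n => [|n IHn]; first by rewrite !expr1.
rewrite expnSr !exprM IHn -!(pFrobenius_autE char_A) pFrobenius_autD_comm //.
exact/commrX/commr_sym/commrX/commr_sym.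
Qed.

(** By Pascal's rule, neighbouring entries of row p-1 add up to an entry of row p. For 0 < j < p
    that entry is divisible by p, so it vanishes in [A] and the sign alternates along row p-1,
    starting from 1. *)
Lemma bin_predp_pchar i : (i < p)%N -> 'C(p.-1, i)%:R = (-1) ^+ i :> A.
Proof.
have p_pr := pcharf_prime char_A.
elim: i => [|i IHi] ltip; first by rewrite bin0.
have /eqP : 'C(p, i.+1)%:R == 0 :> A.
  by rewrite -(dvdn_pcharf char_A) prime_dvd_bin.
rewrite -{1}(prednK (prime_gt0 p_pr)) binS natrD IHi ?(ltnW ltip) // => /eqP.
by rewrite addr_eq0 exprS mulN1r => /eqP.
Qed.

(** Left and right multiplication by x commute, so this is the binomial theorem for L_x - R_x,
    applied to d. *)
Lemma iter_commutator (x d : A) n :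
  iter n (commutator x) d =
  \sum_(i < n.+1) ((-1) ^+ i * (x ^+ (n - i) * d * x ^+ i)) *+ 'C(n, i).
Proof.
elim: n => [|n IHn].
  by rewrite big_ord1 subnn !expr0 !mul1r mulr1 bin0.
rewrite iterS IHn /commutator mulr_sumr mulr_suml.
(* The i = 0 terms on both sides equal x^(n+1) d. Pascal's rule then splits the rest of the
   right-hand side: the 'C(n, i+1) part loses its top term, as 'C(n, n+1) = 0, and matches the rest
   of the L_x sum; the 'C(n, i) part matches the R_x sum. *)
rewrite [RHS]big_ord_recl [X in X - _]big_ord_recl /= !bin0 !subn0 !mulr1n.
rewrite !expr0 !mul1r !mulr1 !mulrA -exprS -addrA; congr (_ + _).
under [RHS]eq_bigr => i _ do rewrite /bump /= add1n subSS binS mulrnDr.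
rewrite big_split /= [X in _ = X + _]big_ord_recr /= bin_small // mulr0n addr0.
rewrite -sumrN; congr (_ + _); apply: eq_bigr => i _.
  rewrite /bump /= add1n mulrnAr; congr (_ *+ _).
  rewrite mulrA commr_sign -!mulrA; congr (_ * _).
  by rewrite !mulrA -exprS subnSK.
by rewrite mulrnAl -mulNrn exprS mulN1r !mulNr -!mulrA -exprSr.
Qed.

Lemma iter_predp_commutator (x d : A) :
  iter p.-1 (commutator x) d = \sum_(i < p) x ^+ (p.-1 - i) * d * x ^+ i.
Proof.
have p_gt0 := prime_gt0 (pcharf_prime char_A).
rewrite iter_commutator prednK //; apply: eq_bigr => i _.
(* The sign from the expansion and the sign of the binomial coefficient cancel. *)
by rewrite -mulr_natl bin_predp_pchar // mulrA -expr2 sqrr_sign mul1r.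
Qed.

End RingLemmas.

Lemma derivation_exprS (A : nzRingType) (D : A -> A) :
  (forall a b, D (a * b) = D a * b + a * D b) ->
  forall x n, D (x ^+ n.+1) = \sum_(i < n.+1) x ^+ (n - i) * D x * x ^+ i.
Proof.
move=> DM x; elim=> [|n IHn]; first by rewrite big_ord1 mul1r mulr1.
rewrite exprS DM IHn [RHS]big_ord_recr /= subnn expr0 mul1r addrC.
congr (_ + _); rewrite mulr_sumr; apply: eq_bigr => i _.
by rewrite !mulrA -exprS subSn // -ltnS.
Qed.

Definition primitive (k : fieldType) (g : lieAlgType k) (y : uea g) : Prop :=
  coprod y = pure y 1 + pure 1 y.

Lemma pspan_primitive (k : fieldType) (p : nat) (g : lieAlgType k) (y : uea g) :
  p \in [pchar k] -> pspan p y -> primitive y.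
Proof.
move=> char_k [s ->]; rewrite /primitive.
have char_T : p \in [pchar (tensor (uea g) (uea g))] by rewrite pchar_lalg.
have pureX1 (z : uea g) n : pure z 1 ^+ n = pure (z ^+ n) (1 : uea g).
  by elim: n => [//|n IHn]; rewrite !exprS IHn pureM mulr1.
have pure1X (z : uea g) n : pure 1 z ^+ n = pure (1 : uea g) (z ^+ n).
  by elim: n => [//|n IHn]; rewrite !exprS IHn pureM mulr1.
have coprodX (z : uea g) n : coprod (z ^+ n) = coprod z ^+ n.
  by elim: n => [|n IHn]; rewrite ?coprod1 // !exprS coprodM IHn.
elim: s => [|[a [x n]] s IHs].
  rewrite !big_nil pure0l raddf0 addr0.
  (* The coproduct of 0 is computed by homogeneity from 0 = 0 *: 1. *)
  by rewrite -[in LHS](scale0r (1 : uea g)) coprodZ scale0r.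
rewrite !big_cons /= coprodD coprodZ IHs coprodX coprod_gen.
rewrite (exprD_pexp_comm char_T); last first.
  by rewrite /GRing.comm !pureM !mulr1 !mul1r.
by rewrite pureX1 pure1X pureDl pureDr pureZl pureZr scalerDr addrACA.
Qed.

Lemma primitive_derivation (k : fieldType) (g : postLieAlgType k)
    (rhdU : uea g -> uea g -> uea g) (y a b : uea g) :
  guin_oudom rhdU -> primitive y ->
  rhdU y (a * b) = rhdU y a * b + a * rhdU y b.
Proof.
move=> go prim_y.
(* For this two-term expansion, [go_mul] gives (y ▷ a)(1 ▷ b) + (1 ▷ a)(y ▷ b), and 1 acts as the
   identity. *)
rewrite (go_mul go a b (s := [:: (y, 1); (1, y)])) ?big_cons ?big_nil /=.
  by rewrite !(go_1l go) addr0.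
by rewrite /sweedler prim_y !big_cons big_nil addr0.
Qed.

Theorem lemma2p7 (k : fieldType) (p : nat) (char_k : p \in [pchar k])
    (g : postLieAlgType k) (rhdU : uea g -> uea g -> uea g)
    (rhdU_go : guin_oudom rhdU) (x y : uea g) :
  pspan p x -> pspan p y ->
  rhdU y (x ^+ p) = iter p.-1 (commutator x) (rhdU y x).
Proof.
move=> _ /(pspan_primitive char_k) prim_y.
have char_U : p \in [pchar (uea g)] by rewrite pchar_lalg.
have derY a b := primitive_derivation a b rhdU_go prim_y.
rewrite (iter_predp_commutator char_U).
(* Primality excludes p = 0; for p = n.+1 the exponent p.-1 - i becomes the n - i of the Leibniz
   expansion. *)
by case: p {char_k} char_U => [/pcharf_prime|n _] //; apply: derivation_exprS.
Qed.
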